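(* Let $\mathcal{K}=(\mathcal{A},g,\{x^1,\dots,x^m\})$ and $\mathcal{K}'=(\mathcal{A}',g',\{y^1,\dots,y^{m'}\})$ be Kähler-Poisson algebras, and set $\mathcal{K}\oplus\mathcal{K}'=(\mathcal{A}\oplus\mathcal{A}',\hat g,\{z^1,\dots,z^{m+m'}\})$ where $$z^I=\begin{cases}(x^I,0)&\text{if } I\in\{1,\dots,m\}\\(0,y^{I-m})&\text{if } I\in\{m+1,\dots,m+m'\},\end{cases}$$ and $$\hat g_{IJ}=\begin{cases}(g_{IJ},0)&\text{if } I,J\in\{1,\dots,m\}\\(0,g'_{I-m,J-m})&\text{if } I,J\in\{m+1,\dots,m+m'\}\\(0,0)&\text{otherwise.}\end{cases}$$ Then $\mathcal{K}\oplus\mathcal{K}'$ is a Kähler-Poisson algebra.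
   Context: Let $\mathbb{K}$ be $\mathbb{R}$ or $\mathbb{C}$. Poisson algebras are commutative associative algebras over $\mathbb{K}$ with a Lie bracket satisfying the Leibniz rule. A Kähler-Poisson algebra is a triple $\mathcal{K}=(\mathcal{A},g,\{x^1,\dots,x^m\})$ where $(\mathcal{A},\{\cdot,\cdot\})$ is a Poisson algebra over $\mathbb{K}$, $x^1,\dots,x^m\in\mathcal{A}$, and $g=(g_{ij})$ is a symmetric $m\times m$ matrix with entries in $\mathcal{A}$, such that there exists $\eta\in\mathcal{A}$ with $\sum_{i,j,k,l=1}^m \eta\{a,x^i\}g_{ij}\{x^j,x^k\}g_{kl}\{x^l,b\}=-\{a,b\}$ for all $a,b\in\mathcal{A}$. The direct sum $\mathcal{A}\oplus\mathcal{A}'$ is a Poisson algebra with componentwise product and Poisson bracket $\{(a_1,a_2),(b_1,b_2)\}=(\{a_1,b_1\},\{a_2,b_2\}')$ for $a_1,b_1\in\mathcal{A}$, $a_2,b_2\in\mathcal{A}'$. *)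

(* Defs.v *)
From HB Require Import structures.
From mathcomp Require Import all_boot all_order all_algebra.
From mathcomp Require Import complex.
From mathcomp Require Import reals.

Set Implicit Arguments.
Unset Strict Implicit.
Unset Printing Implicit Defensive.

Import GRing.Theory.
Local Open Scope ring_scope.

(* Algebras are not assumed to be unital (nor nonzero), hence the product is
   an operation on an [lmodType] and not that of a [comAlgType]. *)
HB.mixin Record isPoissonAlgebra (K : fieldType) A of GRing.Lmodule K A := {
  pmul : A -> A -> A;
  pbracket : A -> A -> A;
  pmulA : associative pmul;
  pmulC : commutative pmul;
  pmul_linearl : forall (k : K) (a b c : A),
    pmul (k *: a + b) c = k *: pmul a c + pmul b c;
  pbracket_linearl : forall (k : K) (a b c : A),
    pbracket (k *: a + b) c = k *: pbracket a c + pbracket b c;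
  pbracket_linearr : forall (k : K) (a b c : A),
    pbracket a (k *: b + c) = k *: pbracket a b + pbracket a c;
  pbracketxx : forall a : A, pbracket a a = 0;
  pbracket_jacobi : forall a b c : A,
    pbracket a (pbracket b c) + pbracket b (pbracket c a)
      + pbracket c (pbracket a b) = 0;
  pbracket_leibniz : forall a b c : A,
    pbracket a (pmul b c) = pmul (pbracket a b) c + pmul b (pbracket a c)
}.

#[short(type="poissonAlgType")]
HB.structure Definition PoissonAlgebra (K : fieldType) :=
  {A of isPoissonAlgebra K A & GRing.Lmodule K A}.

Declare Scope poisson_scope.
Delimit Scope poisson_scope with P.
Notation "a ** b" := (pmul a b) (at level 40, left associativity) :
  poisson_scope.
Notation "{[ a , b ]}" := (pbracket a b)
  (at level 0, format "{[ a ,  b ]}") : poisson_scope.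
Local Open Scope poisson_scope.

Section DirectSum.
Variables (K : fieldType) (A A' : poissonAlgType K).

Definition dsum_mul (a b : A * A') : A * A' := (a.1 ** b.1, a.2 ** b.2).
Definition dsum_bracket (a b : A * A') : A * A' :=
  ({[a.1, b.1]}, {[a.2, b.2]}).

Fact dsum_mulA : associative dsum_mul.
Proof. by move=> a b c; rewrite /dsum_mul /= !pmulA. Qed.

Fact dsum_mulC : commutative dsum_mul.
Proof. by move=> a b; congr pair; apply: pmulC. Qed.

Fact dsum_mul_linearl (k : K) (a b c : A * A') :
  dsum_mul (k *: a + b) c = k *: dsum_mul a c + dsum_mul b c.
Proof. by congr pair; apply: pmul_linearl. Qed.

Fact dsum_bracket_linearl (k : K) (a b c : A * A') :
  dsum_bracket (k *: a + b) c = k *: dsum_bracket a c + dsum_bracket b c.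
Proof. by congr pair; apply: pbracket_linearl. Qed.

Fact dsum_bracket_linearr (k : K) (a b c : A * A') :
  dsum_bracket a (k *: b + c) = k *: dsum_bracket a b + dsum_bracket a c.
Proof. by congr pair; apply: pbracket_linearr. Qed.

Fact dsum_bracketxx (a : A * A') : dsum_bracket a a = 0.
Proof. by congr pair; apply: pbracketxx. Qed.

Fact dsum_bracket_jacobi (a b c : A * A') :
  dsum_bracket a (dsum_bracket b c) + dsum_bracket b (dsum_bracket c a)
    + dsum_bracket c (dsum_bracket a b) = 0.
Proof. by congr pair; apply: pbracket_jacobi. Qed.

Fact dsum_bracket_leibniz (a b c : A * A') :
  dsum_bracket a (dsum_mul b c)
    = dsum_mul (dsum_bracket a b) c + dsum_mul b (dsum_bracket a c).
Proof. by congr pair; apply: pbracket_leibniz. Qed.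

HB.instance Definition _ := isPoissonAlgebra.Build K (A * A')%type
  dsum_mulA dsum_mulC dsum_mul_linearl dsum_bracket_linearl
  dsum_bracket_linearr dsum_bracketxx dsum_bracket_jacobi
  dsum_bracket_leibniz.

End DirectSum.

Definition is_kahler_poisson (K : fieldType) (A : poissonAlgType K) (m : nat)
    (g : 'M[A]_m) (x : 'I_m -> A) : Prop :=
  g^T = g /\
  exists eta : A, forall a b : A,
    \sum_(i < m) \sum_(j < m) \sum_(k < m) \sum_(l < m)
      eta ** {[a, x i]} ** g i j ** {[x j, x k]} ** g k l ** {[x l, b]}
    = - {[a, b]}.

Section KahlerPoissonSum.
Variables (K : fieldType) (A A' : poissonAlgType K) (m m' : nat).

Definition dsum_gen (x : 'I_m -> A) (y : 'I_m' -> A') (I : 'I_(m + m')) :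
    A * A' :=
  match split I with
  | inl i => (x i, 0)
  | inr i => (0, y i)
  end.

Definition dsum_metric (g : 'M[A]_m) (g' : 'M[A']_m') : 'M[A * A']_(m + m') :=
  \matrix_(I, J)
    match split I, split J with
    | inl i, inl j => (g i j, 0)
    | inr i, inr j => (0, g' i j)
    | _, _ => (0, 0)
    end.

End KahlerPoissonSum.

(* Main.v *)
Require Import Defs.
From HB Require Import structures.
From mathcomp Require Import all_boot all_order all_algebra.
From mathcomp Require Import complex.
From mathcomp Require Import reals.

Set Implicit Arguments.
Unset Strict Implicit.
Unset Printing Implicit Defensive.

Import GRing.Theory.
Local Open Scope ring_scope.

(** The Kähler-Poisson condition splits along the two factors. If [eta] and
    [eta'] witness it for the summands, then [(eta, eta')] witnesses it for the
    direct sum: product and bracket are componentwise, so each projection of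
    the quadruple sum over [m + m'] indices is the quadruple sum for the
    projected metric and generators ([kp_sum_fst], [kp_sum_snd]). The
    projected generators vanish on the indices of the other factor, and a
    summand is zero as soon as one of its four generators is, because a bracket
    with zero is zero. Hence only the indices of the factor itself contribute
    ([kp_sum_reindex]), which leaves exactly the original sum. *)

Local Open Scope poisson_scope.

Section ZeroLaws.
Variables (K : fieldType) (A : poissonAlgType K).

(* Linearity comes as one law for [k *: a + b]; the choice [k = -1], [a = b]
   extracts preservation of zero from it. *)
Lemma pmul0l (a : A) : 0 ** a = 0.
Proof. by have := pmul_linearl (-1) a a a; rewrite !scaleN1r !addNr. Qed.

Lemma pmul0r (a : A) : a ** 0 = 0.
Proof. by rewrite pmulC pmul0l. Qed.

Lemma pbracket0l (a : A) : {[0, a]} = 0.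
Proof. by have := pbracket_linearl (-1) a a a; rewrite !scaleN1r !addNr. Qed.

Lemma pbracket0r (a : A) : {[a, 0]} = 0.
Proof. by have := pbracket_linearr (-1) a a a; rewrite !scaleN1r !addNr. Qed.

End ZeroLaws.

Section KahlerPoissonForm.
Variables (K : fieldType) (A : poissonAlgType K).

(** Indices range over an arbitrary finite type, so that the two embeddings of
    the index sets of the factors can be treated alike. *)
Definition kp_term (I : Type) (eta : A) (g : I -> I -> A) (x : I -> A)
    (a b : A) (i j k l : I) : A :=
  eta ** {[a, x i]} ** g i j ** {[x j, x k]} ** g k l ** {[x l, b]}.

Definition kp_sum (I : finType) (eta : A) (g : I -> I -> A) (x : I -> A)
    (a b : A) : A :=
  \sum_i \sum_j \sum_k \sum_l kp_term eta g x a b i j k l.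

Lemma kp_term_eq0 (I : Type) eta (g : I -> I -> A) x a b i j k l :
  [\/ x i = 0, x j = 0, x k = 0 | x l = 0] ->
  kp_term eta g x a b i j k l = 0.
Proof.
rewrite /kp_term; case=> ->.
all: by rewrite ?(pbracket0l, pbracket0r, pmul0l, pmul0r).
Qed.

Lemma eq_kp_sum (I : finType) eta (g g' : I -> I -> A) x x' a b :
  g =2 g' -> x =1 x' -> kp_sum eta g x a b = kp_sum eta g' x' a b.
Proof.
move=> eg ex; do 4 ![apply: eq_bigr => ? _].
by rewrite /kp_term !eg !ex.
Qed.

Lemma sum_reindex_supp (V : nmodType) (I J : finType) (h : I -> J)
    (F : J -> V) :
  injective h -> (forall j, j \notin codom h -> F j = 0) ->
  \sum_j F j = \sum_i F (h i).
Proof.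
move=> h_inj F0; rewrite (bigID (mem (codom h))) /= [X in _ + X]big1 // addr0.
rewrite -big_uniq /=; last by rewrite map_inj_uniq ?enum_uniq.
by rewrite big_map big_enum.
Qed.

(** Each of the four summation indices is also the index of a generator inside
    a bracket, so it can be restricted to the nonzero generators with no
    assumption on the metric. *)
Lemma kp_sum_reindex (I J : finType) (h : I -> J) eta (g : J -> J -> A) x a b :
  injective h -> (forall j, j \notin codom h -> x j = 0) ->
  kp_sum eta g x a b
  = kp_sum eta (fun i j => g (h i) (h j)) (x \o h) a b.
Proof.
move=> h_inj x0; rewrite /kp_sum.
rewrite (sum_reindex_supp h_inj) => [|i /x0 xi0]; last first.
  do 3 ![apply: big1 => ? _].
  by apply: kp_term_eq0; constructor 1.
apply: eq_bigr => i _.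
rewrite (sum_reindex_supp h_inj) => [|j /x0 xj0]; last first.
  do 2 ![apply: big1 => ? _].
  by apply: kp_term_eq0; constructor 2.
apply: eq_bigr => j _.
rewrite (sum_reindex_supp h_inj) => [|k /x0 xk0]; last first.
  apply: big1 => ? _.
  by apply: kp_term_eq0; constructor 3.
apply: eq_bigr => k _.
rewrite (sum_reindex_supp h_inj) // => l /x0 xl0.
by apply: kp_term_eq0; constructor 4.
Qed.

End KahlerPoissonForm.

Section Projections.
Variables (K : fieldType) (A A' : poissonAlgType K) (I : finType).
Variables (eta : A * A') (g : I -> I -> A * A') (x : I -> A * A').
Variables (a b : A * A').

Lemma kp_sum_fst :
  (kp_sum eta g x a b).1
  = kp_sum eta.1 (fun i j => (g i j).1) (fun i => (x i).1) a.1 b.1.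
Proof. by do 4 ![rewrite raddf_sum; apply: eq_bigr => ? _]. Qed.

Lemma kp_sum_snd :
  (kp_sum eta g x a b).2
  = kp_sum eta.2 (fun i j => (g i j).2) (fun i => (x i).2) a.2 b.2.
Proof. by do 4 ![rewrite raddf_sum; apply: eq_bigr => ? _]. Qed.

End Projections.

Section DirectSumData.
Variables (K : fieldType) (A A' : poissonAlgType K) (m m' : nat).
Variables (g : 'M[A]_m) (x : 'I_m -> A) (g' : 'M[A']_m') (y : 'I_m' -> A').

Lemma split_lshift (i : 'I_m) : split (lshift m' i) = inl i.
Proof. exact: (unsplitK (inl i)). Qed.

Lemma split_rshift (i : 'I_m') : split (rshift m i) = inr i.
Proof. exact: (unsplitK (inr i)). Qed.

Lemma dsum_gen_fst_eq0 (I : 'I_(m + m')) :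
  I \notin codom (@lshift m m') -> (dsum_gen x y I).1 = 0.
Proof.
rewrite /dsum_gen; case: split_ordP => // i ->.
by rewrite codom_f.
Qed.

Lemma dsum_gen_snd_eq0 (I : 'I_(m + m')) :
  I \notin codom (@rshift m m') -> (dsum_gen x y I).2 = 0.
Proof.
rewrite /dsum_gen; case: split_ordP => // i ->.
by rewrite codom_f.
Qed.

Lemma dsum_metric_sym :
  g^T = g -> g'^T = g' -> (dsum_metric g g')^T = dsum_metric g g'.
Proof.
move=> /matrixP gT /matrixP g'T; apply/matrixP => I J; rewrite !mxE.
case: (split I) => i; case: (split J) => j //.
- by rewrite -[in LHS]gT mxE.
- by rewrite -[in LHS]g'T mxE.
Qed.

End DirectSumData.

Theorem proposition5p1 (R : realType) (K : fieldType)
    (hK : K = R :> fieldType \/ K = R[i] :> fieldType)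
    (A A' : poissonAlgType K) (m m' : nat)
    (g : 'M[A]_m) (x : 'I_m -> A) (g' : 'M[A']_m') (y : 'I_m' -> A') :
  is_kahler_poisson g x -> is_kahler_poisson g' y ->
  is_kahler_poisson (dsum_metric g g') (dsum_gen x y).
Proof.
move=> [g_sym [eta eta_kp]] [g'_sym [eta' eta'_kp]].
split; first exact: dsum_metric_sym.
exists (eta, eta') => a b.
rewrite -[LHS]/(kp_sum (eta, eta') (dsum_metric g g') (dsum_gen x y) a b).
rewrite [LHS]surjective_pairing kp_sum_fst kp_sum_snd.
rewrite (kp_sum_reindex _ _ _ _ (@lshift_inj m m') (dsum_gen_fst_eq0 _ _)).
rewrite (kp_sum_reindex _ _ _ _ (@rshift_inj m m') (dsum_gen_snd_eq0 _ _)).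
congr pair.
- rewrite -[RHS]eta_kp; apply: eq_kp_sum => [i j|i] /=.
  + by rewrite mxE !split_lshift.
  + by rewrite /dsum_gen split_lshift.
- rewrite -[RHS]eta'_kp; apply: eq_kp_sum => [i j|i] /=.
  + by rewrite mxE !split_rshift.
  + by rewrite /dsum_gen split_rshift.
Qed.
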